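(* The problem Binary DTW-Mean is solvable with $O(kn^3)$ arithmetic operations, where $k$ is the number of input time series and $n$ is the maximum length of any input time series. That is, there is an algorithm which, given time series $x^{(1)},\ldots,x^{(k)}\in\{0,1\}^*$ of maximum length $n$ and rational nonnegative weights $w_1,\ldots,w_k$, outputs, using $O(kn^3)$ arithmetic operations, a time series $z\in\{0,1\}^*$ that minimizes $F_w(z)=\sum_{i=1}^k w_i\,\mathrm{dtw}(z,x^{(i)})^2$ over all time series in $\{0,1\}^*$.
   Context: A time series of length $n\ge 1$ is a sequence $x=(x_1,\ldots,x_n)\in\mathbb{Q}^n$. Here $\{0,1\}^*$ denotes the set of all finite (nonempty) time series with elements in $\{0,1\}$, and $[n]=\{1,\ldots,n\}$. A warping path of order $m\times n$ is a sequence $p=(p_1,\ldots,p_L)$ with $p_\ell\in[m]\times[n]$ such that $p_1=(1,1)$, $p_L=(m,n)$, and $p_{\ell+1}-p_\ell\in\{(1,0),(0,1),(1,1)\}$ for all $\ell\in[L-1]$. The set of all of them is $\mathcal{P}_{m,n}$. For time series $x$ of length $m$ and $y$ of length $n$ and $p=((i_1,j_1),\ldots,(i_L,j_L))\in\mathcal{P}_{m,n}$, the cost is $C_p(x,y)=\sum_{\ell=1}^L(x_{i_\ell}-y_{j_\ell})^2$, and the dtw-distance is $\mathrm{dtw}(x,y)=\min_{p\in\mathcal{P}_{m,n}}\sqrt{C_p(x,y)}$. Binary DTW-Mean. Input: a sample of $k$ time series $x^{(1)},\ldots,x^{(k)}$ with elements in $\{0,1\}$ and rational nonnegative weights $w_1,\ldots,w_k$.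 Task: find $z\in\{0,1\}^*$ minimizing $F_w(z)=\sum_{i=1}^k w_i\,\mathrm{dtw}(z,x^{(i)})^2$. Running time is measured as the number of arithmetic operations (including comparisons) on rational numbers. *)

(* Defs.v *)
From mathcomp Require Import all_boot all_order all_algebra.
From mathcomp Require Import boolp classical_sets reals.
Set Implicit Arguments.
Unset Strict Implicit.
Unset Printing Implicit Defensive.
Import Order.TTheory GRing.Theory Num.Theory.
Local Open Scope ring_scope.

(* A time series is a nonempty [seq rat].  Positions are counted from 0, so a
   warping path of order m x n runs from (0, 0) to (m - 1, n - 1). *)

Definition warping_step (a b : nat * nat) : bool :=
  [|| b == (a.1.+1, a.2), b == (a.1, a.2.+1) | b == (a.1.+1, a.2.+1)].

Definition warping_path (m n : nat) (p : seq (nat * nat)) : bool :=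
  [&& p != [::], all (fun a => (a.1 < m)%N && (a.2 < n)%N) p,
      head (0, 0)%N p == (0, 0)%N, last (0, 0)%N p == (m.-1, n.-1)
    & sorted warping_step p].

Definition path_cost (x y : seq rat) (p : seq (nat * nat)) : rat :=
  \sum_(a <- p) (nth 0 x a.1 - nth 0 y a.2) ^+ 2.

(* The infimum is a minimum when x and y are nonempty: see [dtw_min]. *)
Definition dtw (R : realType) (x y : seq rat) : R :=
  inf [set Num.sqrt (ratr (path_cost x y p)) | p in
        [set p | warping_path (size x) (size y) p]]%classic.

Definition binary_series (x : seq rat) : bool :=
  (x != [::]) && all (fun a => (a == 0) || (a == 1)) x.

Definition frechet (R : realType) (k : nat) (x : 'I_k -> seq rat)
    (w : 'I_k -> rat) (z : seq rat) : R :=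
  \sum_(i < k) ratr (w i) * dtw R z (x i) ^+ 2.

(* A uniform random access machine over exact rational numbers, presented as a
   structured language.  Its memory consists of arrays, named by a number that
   is fixed in the program text; each array has one rational cell per natural
   number.  Addresses are computed by the same rational arithmetic as data.
   An access at an address that is not a natural number and a division by 0
   have no value, and a program that attempts one has no [exec] derivation. *)

Inductive arith := Add | Sub | Mul | Div.

Inductive relop := RLt | RLe | REq.

Inductive expr :=
| Const (q : rat)
| Read (a : nat) (e : expr)
| Op (o : arith) (e1 e2 : expr).

Inductive test := Test (c : relop) (e1 e2 : expr).

Inductive prog :=
| Skip
| Write (a : nat) (e1 e2 : expr)
| Seq (P Q : prog)
| If (b : test) (P Q : prog)
| While (b : test) (P : prog).

Definition store := nat -> nat -> rat.

Definition update (s : store) (a i : nat) (v : rat) : store :=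
  fun b j => if (b == a) && (j == i) then v else s b j.

Definition arith_val (o : arith) (u v : rat) : rat :=
  match o with
  | Add => u + v
  | Sub => u - v
  | Mul => u * v
  | Div => u / v
  end.

Definition relop_val (c : relop) (u v : rat) : bool :=
  match c with
  | RLt => u < v
  | RLe => u <= v
  | REq => u == v
  end.

Inductive eval (s : store) : expr -> rat -> Prop :=
| EvConst q : eval s (Const q) q
| EvRead a e i : eval s e i%:R -> eval s (Read a e) (s a i)
| EvOp o e1 e2 u v : eval s e1 u -> eval s e2 v ->
    (o = Div -> v != 0) -> eval s (Op o e1 e2) (arith_val o u v).

Inductive eval_test (s : store) : test -> bool -> Prop :=
| EvTest c e1 e2 u v : eval s e1 u -> eval s e2 v ->
    eval_test s (Test c e1 e2) (relop_val c u v).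

Fixpoint expr_ops (e : expr) : nat :=
  match e with
  | Const _ => 0
  | Read _ e => expr_ops e
  | Op _ e1 e2 => (expr_ops e1 + expr_ops e2).+1
  end.

Definition test_ops (b : test) : nat :=
  let: Test _ e1 e2 := b in (expr_ops e1 + expr_ops e2).+1.

(* [exec P s t s']: started on s, the program P halts in s' after t arithmetic
   operations and comparisons, those on addresses and loop counters included.
   Reads and writes are not counted; every branch and every loop iteration
   costs a comparison, so the number of reads and writes in a run is at most a
   constant depending on P times t + 1. *)
Inductive exec : prog -> store -> nat -> store -> Prop :=
| ExSkip s : exec Skip s 0 s
| ExWrite s a e1 e2 i v : eval s e1 i%:R -> eval s e2 v ->
    exec (Write a e1 e2) s (expr_ops e1 + expr_ops e2) (update s a i v)
| ExSeq s s1 s2 t1 t2 P Q : exec P s t1 s1 -> exec Q s1 t2 s2 ->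
    exec (Seq P Q) s (t1 + t2) s2
| ExIf s s1 t b r P Q : eval_test s b r ->
    exec (if r then P else Q) s t s1 ->
    exec (If b P Q) s (test_ops b + t) s1
| ExWhileF s b P : eval_test s b false ->
    exec (While b P) s (test_ops b) s
| ExWhileT s s1 s2 t1 t2 b P : eval_test s b true ->
    exec P s t1 s1 -> exec (While b P) s1 t2 s2 ->
    exec (While b P) s (test_ops b + t1 + t2) s2.

(* The input is a word of rationals in array 0, all other cells being 0. *)
Definition load (u : seq rat) : store :=
  fun a i => if a == 0%N then nth 0 u i else 0.

(* The output is the word of rationals that starts array 1. *)
Definition holds_output (s : store) (v : seq rat) : Prop :=
  forall i, (i < size v)%N -> s 1%N i = nth 0 v i.

(* Words that start with their length, so that their end can be found. *)
Definition encode_series (x : seq rat) : seq rat := (size x)%:R :: x.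

Definition encode_sample (k : nat) (x : 'I_k -> seq rat) (w : 'I_k -> rat) :
    seq rat :=
  k%:R :: flatten [seq w i :: encode_series (x i) | i <- enum 'I_k].

Lemma eval_det s e u v : eval s e u -> eval s e v -> u = v.
Proof.
move=> Hu; elim: Hu v => {e u} [q|a e i _ IH|o e1 e2 u v _ IH1 _ IH2 _] r Hr.
- by inversion Hr.
- inversion Hr as [|a' e' j Hj|]; subst.
  by have /eqP := IH _ Hj; rewrite eqr_nat => /eqP ->.
- by inversion Hr; subst; congr (arith_val _ _ _); [apply: IH1|apply: IH2].
Qed.

Lemma eval_test_det s b r r' : eval_test s b r -> eval_test s b r' -> r = r'.
Proof.
case=> c e1 e2 u v Hu Hv Hr; inversion Hr; subst.
by congr (relop_val _ _ _); apply: eval_det; eassumption.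
Qed.

Lemma exec_det P s t s1 t' s1' :
  exec P s t s1 -> exec P s t' s1' -> t = t' /\ s1 = s1'.
Proof.
move=> H; elim: H t' s1' => {P s t s1}.
- by move=> s t' s1' H; inversion H.
- move=> s a e1 e2 i v H1 H2 t' s1' H; inversion H; subst.
  have /eqP := eval_det H1 ltac:(eassumption).
  rewrite eqr_nat => /eqP ->.
  by rewrite (eval_det H2 ltac:(eassumption)).
- move=> s s1 s2 t1 t2 P Q _ IH1 _ IH2 t' s1' H.
  inversion H as [| |? u1 ? ? ? ? ? G1 G2| | |]; subst.
  have [? ?] := IH1 _ _ G1; subst.
  by have [-> ->] := IH2 _ _ G2.
- move=> s s1 t b r P Q Hb _ IH t' s1' H.
  inversion H as [| | |? ? ? ? r' ? ? Hb' G| |]; subst.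
  rewrite -(eval_test_det Hb Hb') in G.
  by have [-> ->] := IH _ _ G.
- move=> s b P Hb t' s1' H.
  inversion H as [| | | |? ? ? Hb'|? ? ? ? ? ? ? Hb']; subst => //.
  by have := eval_test_det Hb Hb'.
- move=> s s1 s2 t1 t2 b P Hb _ IH1 _ IH2 t' s1' H.
  inversion H as [| | | |? ? ? Hb'|? ? ? ? ? ? ? Hb' G1 G2]; subst.
    by have := eval_test_det Hb Hb'.
  have [? ?] := IH1 _ _ G1; subst.
  by have [-> ->] := IH2 _ _ G2.
Qed.

Lemma warping_path_exists m n : (0 < m)%N -> (0 < n)%N ->
  exists p, warping_path m n p.
Proof.
have mono m1 n1 m2 n2 (p : seq (nat * nat)) : (m1 <= m2)%N -> (n1 <= n2)%N ->
    all (fun a => (a.1 < m1)%N && (a.2 < n1)%N) p ->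
    all (fun a => (a.1 < m2)%N && (a.2 < n2)%N) p.
  move=> hm hn; apply: sub_all => a /andP[h1 h2].
  by rewrite (leq_trans h1) // (leq_trans h2).
have ext m1 n1 m2 n2 (p : seq (nat * nat)) :
    (m1 <= m2)%N -> (n1 <= n2)%N -> (0 < m2)%N -> (0 < n2)%N ->
    warping_step (m1.-1, n1.-1) (m2.-1, n2.-1) ->
    warping_path m1 n1 p -> warping_path m2 n2 (rcons p (m2.-1, n2.-1)).
  move=> hm hn m0 n0 st /and5P[]; case: p => // a p _ al hd ls so.
  apply/and5P; split => //.
  - by rewrite all_rcons /= !ltn_predL m0 n0; apply: mono al.
  - by rewrite last_rcons.
  - by rewrite /= rcons_path; move: so ls => /= -> /eqP ->.
case: m => // m; case: n => // n _ _.
elim: m => [|m [p Hp]]; last first.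
  exists (rcons p (m.+1, n)); apply: (ext m.+1 n.+1 m.+2 n.+1) => //.
  by rewrite /warping_step /= eqxx.
elim: n => [|n [p Hp]]; first by exists [:: (0, 0)%N].
exists (rcons p (0, n.+1)%N); apply: (ext 1%N n.+1 1%N n.+2) => //.
by rewrite /warping_step /= eqxx ?orbT.
Qed.

Lemma warping_path_size m n p : warping_path m n p -> (size p <= m + n)%N.
Proof.
case/and5P=> _ al _ _ so.
pose f (a : nat * nat) := (a.1 + a.2)%N.
have so' : sorted ltn (map f p).
  rewrite sorted_map; apply: sub_sorted so => a b.
  case/or3P=> /eqP -> /=; rewrite /f /=.
  - by rewrite addSn.
  - by rewrite addnS.
  - by rewrite addSn addnS.
rewrite -(size_map f) -[leqRHS](size_iota 0).
apply: uniq_leq_size; first exact: sorted_uniq ltn_trans ltnn _ so'.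
move=> _ /mapP[a ap ->]; rewrite mem_iota add0n leq0n /=.
by have /andP[h1 h2] := allP al _ ap; rewrite -addnS leq_add // ltnW.
Qed.

Lemma path_cost_ge0 x y p : 0 <= path_cost x y p.
Proof. by apply: sumr_ge0 => a _; rewrite sqr_ge0. Qed.

Lemma path_cost_min (x y : seq rat) : x != [::] -> y != [::] ->
  exists2 p, warping_path (size x) (size y) p &
    forall q, warping_path (size x) (size y) q ->
      path_cost x y p <= path_cost x y q.
Proof.
move=> x0 y0; pose m := size x; pose n := size y.
have [m0 n0] : (0 < m)%N /\ (0 < n)%N by rewrite !lt0n !size_eq0.
pose T := (m + n).-bseq ('I_m.+1 * 'I_n.+1)%type.
pose v (b : T) := [seq (val a.1, val a.2) | a <- b] : seq (nat * nat).
have vP p : warping_path m n p -> exists b, v b = p.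
  move=> Hp.
  pose q := [seq (@inord m a.1, @inord n a.2) | a <- p].
  have Hq : (size q <= m + n)%N by rewrite size_map warping_path_size.
  exists (Bseq Hq); rewrite /v /q /= -map_comp -[RHS]map_id.
  apply/eq_in_map => -[i j] ij /=.
  have /and5P[_ /allP/(_ _ ij)/andP[/= h1 h2] _ _ _] := Hp.
  by rewrite !inordK // ltnW.
have [p0 Hp0] := warping_path_exists m0 n0.
have [b0 Eb0] := vP _ Hp0.
have H0 : warping_path m n (v b0) by rewrite Eb0.
case: (@arg_minP _ _ T b0 (fun b => warping_path m n (v b))
  (fun b => path_cost x y (v b)) H0) => b Hb min.
exists (v b) => // q Hq; have [c Ec] := vP _ Hq.
by rewrite -Ec; apply: min; rewrite Ec.
Qed.

Lemma dtw_min (R : realType) (x y : seq rat) : x != [::] -> y != [::] ->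
  exists2 p, warping_path (size x) (size y) p &
    dtw R x y = Num.sqrt (ratr (path_cost x y p)) /\
    forall q, warping_path (size x) (size y) q ->
      dtw R x y <= Num.sqrt (ratr (path_cost x y q)).
Proof.
move=> x0 y0; have [p Hp min] := path_cost_min x0 y0.
have minR q : warping_path (size x) (size y) q ->
    Num.sqrt (ratr (path_cost x y p)) <=
      Num.sqrt (ratr (path_cost x y q)) :> R.
  by move=> Hq; rewrite ler_sqrt ?ler0q ?path_cost_ge0 // ler_rat min.
have E : dtw R x y = Num.sqrt (ratr (path_cost x y p)).
  apply/eqP; rewrite eq_le; apply/andP; split.
    apply: ge_inf; last by exists p.
    by exists (Num.sqrt (ratr (path_cost x y p))) => _ [q Hq <-]; apply: minR.
  apply: lb_le_inf; first by exists (Num.sqrt (ratr (path_cost x y p))), p.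
  by move=> _ [q Hq <-]; apply: minR.
by exists p => //; split => // q Hq; rewrite E minR.
Qed.

(* Main.v *)
(* The mean can be taken alternating (0101.. or 1010..): a warping path for a
   binary series z projects onto its runs without growing in cost.  For an
   alternating z longer than twice the length of x, dropping two elements does
   not increase dtw(z, x), so only lengths up to 2n matter.  One dynamic
   programming table between the alternating series of length 2n and x contains,
   in its last column, the squared distances of all these candidates to x; hence
   filling two tables for every x suffices, in O(k n^2) operations. *)
Require Import Defs.
From mathcomp Require Import all_boot all_order all_algebra.
From mathcomp Require Import boolp classical_sets reals.
From mathcomp Require Import zify lra.
Import Order.TTheory GRing.Theory Num.Theory.
Local Open Scope ring_scope.

(** * The dynamic program and alternating series *)

(** Once [dtw] is identified with a table entry, warping paths disappear: both facts about
    alternating series become inequalities between table entries, proved by induction on [i + j]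
    along an optimal last step. Two elements are dropped rather than one so that [alt b] has the
    same value at the end before and after, hence the same last local cost. The table takes
    functions on [nat], because an entry sees only initial segments; the nested [row] makes the
    recursion on two indices structural. [dtw] is a real infimum of square roots while the machine
    has only rationals, so everything is phrased with squared distances, which are rational table
    entries. Cost bounds have the form [exists K, forall ...], with [K] fixed before the input. Each
    loop is known to run at least once, so its fixed overhead can be charged to its iterations. *)

Fixpoint dtab (f g : nat -> rat) (i : nat) : nat -> rat :=
  fix row (j : nat) : rat :=
    (f i - g j) ^+ 2 +
    match i, j with
    | 0, 0 => 0
    | 0, j'.+1 => row j'
    | i'.+1, 0 => dtab f g i' 0
    | i'.+1, j'.+1 =>
        Order.min (dtab f g i' j) (Order.min (row j') (dtab f g i' j'))
    end.

Arguments dtab : simpl never.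

Lemma dtab00 f g : dtab f g 0 0 = (f 0%N - g 0%N) ^+ 2.
Proof. exact: addr0. Qed.

Lemma dtab0S f g j : dtab f g 0 j.+1 = (f 0%N - g j.+1) ^+ 2 + dtab f g 0 j.
Proof. by []. Qed.

Lemma dtabS0 f g i : dtab f g i.+1 0 = (f i.+1 - g 0%N) ^+ 2 + dtab f g i 0.
Proof. by []. Qed.

Lemma dtabSS f g i j : dtab f g i.+1 j.+1 = (f i.+1 - g j.+1) ^+ 2 +
  Order.min (dtab f g i j.+1)
    (Order.min (dtab f g i.+1 j) (dtab f g i j)).
Proof. by []. Qed.

Lemma dtab_step f g a b : warping_step a b ->
  dtab f g b.1 b.2 <= (f b.1 - g b.2) ^+ 2 + dtab f g a.1 a.2.
Proof.
case: a b => i j [i' j'] /or3P[] /eqP[-> ->] /=.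
- by case: j => // j; rewrite dtabSS lerD2l ge_min lexx.
- by case: i => // i; rewrite dtabSS lerD2l !ge_min lexx ?orbT.
- by rewrite dtabSS lerD2l !ge_min lexx ?orbT.
Qed.

(** Counterpart of [dtab_step]: every predecessor bounds an entry from above, and one attains it.
    Later inductions follow that predecessor and need not unfold the minimum. *)
Lemma dtab_pred f g i j : (i, j) != (0, 0)%N ->
  exists2 a, warping_step a (i, j) &
    dtab f g i j = (f i - g j) ^+ 2 + dtab f g a.1 a.2.
Proof.
case: i j => [|i] [|j] // _.
- by exists (0, j)%N => //; rewrite /warping_step eqxx ?orbT.
- by exists (i, 0)%N => //; rewrite /warping_step eqxx ?orbT.
- rewrite dtabSS; case: (leP (dtab f g i j.+1)) => _.
    by exists (i, j.+1) => //; rewrite /warping_step eqxx ?orbT.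
  case: leP => _.
    by exists (i.+1, j) => //; rewrite /warping_step eqxx ?orbT.
  by exists (i, j) => //; rewrite /warping_step eqxx ?orbT.
Qed.

Lemma dtab_path_le x y p : p != [::] -> head (0, 0)%N p == (0, 0)%N ->
  sorted warping_step p ->
  let a := last (0, 0)%N p in dtab (nth 0 x) (nth 0 y) a.1 a.2 <= path_cost x y p.
Proof.
elim/last_ind: p => [|p b IH] // _; rewrite last_rcons /path_cost -cats1 big_cat.
rewrite big_seq1 /=; case: p IH => [|a p] IH /=.
  by move/eqP=> -> _; rewrite big_nil dtab00 add0r.
move=> hd; rewrite cat_path /= andbT => /andP[so st].
apply: le_trans (dtab_step _ _ _ _ st) _.
by rewrite addrC; apply: lerD => //; apply: IH.
Qed.

Lemma dtab_path_eq x y i j : exists2 p, warping_path i.+1 j.+1 p &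
  path_cost x y p = dtab (nth 0 x) (nth 0 y) i j.
Proof.
have [n] := ubnP (i + j)%N; elim: n i j => // n IH i j ltn.
have [[-> ->]|ne] := eqVneq (i, j) (0, 0)%N.
  by exists [:: (0, 0)%N] => //; rewrite /path_cost big_seq1 dtab00.
have [[i' j'] st ->] := dtab_pred (nth 0 x) (nth 0 y) _ _ ne.
have lt_ij : [&& (i' + j' < i + j)%N, (i' <= i)%N & (j' <= j)%N].
  by case/or3P: st => /eqP[-> ->] /=; apply/and3P; split; lia.
have /and3P[lt1 lei lej] := lt_ij; rewrite /=.
have [p /and5P[p0 al hd ls so] <-] := IH i' j' ltac:(lia).
exists (rcons p (i, j)); last first.
  by rewrite /path_cost -cats1 big_cat big_seq1 /= addrC.
case: p p0 al hd ls so => // a p _ al hd ls so; apply/and5P; split => //.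
- rewrite all_rcons /= !ltnSn /=; apply: sub_all al => b /andP[/= h1 h2].
  by apply/andP; split; lia.
- by rewrite last_rcons.
- by rewrite /= rcons_path; move: ls so => /= /eqP -> ->.
Qed.

(** The cheapest path from [dtw_min] and the path realizing the table entry bound each other;
    squaring cancels the root because path costs are nonnegative. *)
Lemma dtw_sqr (R : realType) x y : x != [::] -> y != [::] ->
  dtw R x y ^+ 2 = ratr (dtab (nth 0 x) (nth 0 y) (size x).-1 (size y).-1).
Proof.
move=> x0 y0; have [p Hp [E min]] := dtw_min R x0 y0.
have [q] := dtab_path_eq x y (size x).-1 (size y).-1.
rewrite !prednK ?lt0n ?size_eq0 // => Hq Eq.
suff -> : dtw R x y = Num.sqrt (ratr (path_cost x y q)).
  by rewrite sqr_sqrtr ?Eq // ler0q -Eq path_cost_ge0.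
apply/eqP; rewrite eq_le min //= E ler_sqrt ?ler0q ?path_cost_ge0 // ler_rat Eq.
case/and5P: Hp => p0 _ hd /eqP ls so.
by have := dtab_path_le x y p p0 hd so; rewrite ls.
Qed.

(** * Alternating series: compression to runs and shortening *)

Definition alt (b : bool) (i : nat) : rat := (b (+) odd i)%:R.

Lemma altS b i : 1 - alt b i = alt b i.+1.
Proof. by rewrite /alt /=; case: b; case: odd; rewrite ?subrr ?subr0. Qed.

(** This identifies the finite series [mkseq (alt b) l.+1] with the infinite [alt b] whose rows the
    program fills. *)
Lemma eq_dtab f f' g g' i j :
  (forall i', (i' <= i)%N -> f i' = f' i') ->
  (forall j', (j' <= j)%N -> g j' = g' j') ->
  dtab f g i j = dtab f' g' i j.
Proof.
elim: i j => [|i IHi] j.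
  elim: j => [|j IHj] Hf Hg; first by rewrite !dtab00 Hf ?Hg.
  by rewrite !dtab0S Hf ?Hg ?IHj // => j' le; apply: Hg; lia.
elim: j => [|j IHj] Hf Hg.
  by rewrite !dtabS0 Hf ?Hg ?IHi // => i' le; apply: Hf; lia.
rewrite !dtabSS Hf ?Hg // IHj // ?IHi ?(IHi j) //;
  by move=> *; (apply: Hf || apply: Hg); lia.
Qed.

(* The number of value changes along [f 0 .. f i]: the index in the alternating
   series of the run of f that contains i. *)
Fixpoint changes (f : nat -> rat) (i : nat) : nat :=
  if i is i'.+1 then (changes f i' + (f i'.+1 != f i'))%N else 0.

Lemma alt_changes f (b : bool) i : (forall i', (i' <= i)%N -> f i' = 0 \/ f i' = 1) ->
  f 0%N = b%:R -> f i = alt b (changes f i).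
Proof.
elim: i => [|i IH] Hf f0; first by rewrite f0 /alt addbF.
have /(_ f0) := IH (fun i' h => Hf i' (leqW h)).
have neq01 : (1 == 0 :> rat) = false by [].
rewrite /= /alt oddD oddb; case: (Hf i (leqnSn i)) => ->;
case: (Hf i.+1 (leqnn _)) => ->; rewrite ?eqxx ?neq01 ?(eq_sym 0 1) ?neq01 /=;
by case: b {f0 IH}; case: odd.
Qed.

(** Under [changes] an optimal last step for [f] becomes either a warping step, with the same local
    cost by [alt_changes], or a standstill. *)
Lemma dtab_alt_le f g (b : bool) i j :
  (forall i', (i' <= i)%N -> f i' = 0 \/ f i' = 1) -> f 0%N = b%:R ->
  dtab (alt b) g (changes f i) j <= dtab f g i j.
Proof.
move=> Hf f0; have [n] := ubnP (i + j)%N; elim: n i j Hf => // n IH i j Hf ltn.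
have [[-> ->]|ne] := eqVneq (i, j) (0, 0)%N.
  by rewrite !dtab00 f0 /alt addbF.
have [[i' j'] st ->] := dtab_pred f g _ _ ne.
have c0 : 0 <= (f i - g j) ^+ 2 by apply: sqr_ge0.
have {}IH : dtab (alt b) g (changes f i') j' <= dtab f g i' j'.
  apply: IH; last by case/or3P: st => /eqP[ei ej]; lia.
  by move=> l le; apply: Hf; case/or3P: st => /eqP[ei ej]; lia.
(* Standstill: the step stays inside one run of [f] with [j] fixed, and its nonnegative local cost
   is dropped. *)
have [E|E] := eqVneq (changes f i', j') (changes f i, j).
  by case: E IH => -> -> IH; rewrite -[leLHS]add0r lerD.
apply: (@le_trans _ _
  ((f i - g j) ^+ 2 + dtab (alt b) g (changes f i') j')); last first.
  by rewrite lerD2l.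
rewrite (alt_changes f b i) //.
apply: (dtab_step (alt b) g (changes f i', j') (changes f i, j)).
move: E; case/or3P: st => /eqP[-> ->] /=; rewrite /warping_step /= ?eqxx ?orbT //.
- by case: (f _ != _); rewrite ?addn1 ?addn0 ?eqxx.
- by case: (f _ != _); rewrite ?addn1 ?addn0 ?eqxx ?orbT.
Qed.

(** The last steps into rows [i] and [i.+2] cost the same since [alt b] has period two, so it
    suffices to compare predecessors by induction. A step that lowers [j] lowers [j.*2] by two and
    [i] by at most one, so the hypothesis survives it. *)
Lemma dtab_alt_shrink b g i j : (j.*2 <= i)%N ->
  dtab (alt b) g i j <= dtab (alt b) g i.+2 j.
Proof.
have P l : alt b l.+2 = alt b l by rewrite /alt /= negbK.
have c0 l l' : 0 <= (alt b l - g l') ^+ 2 by apply: sqr_ge0.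
have stp a a' := dtab_step (alt b) g a a'.
have [n] := ubnP (i + j)%N; elim: n i j => // n IH i j ltn le.
case: j => [|j] in ltn le *.
  by rewrite !dtabS0 addrA lerDr addr_ge0.
case: i => [|i] in ltn le *; first by [].
rewrite doubleS in le.
have s1 := stp (i.+1, j) (i.+1, j.+1) ltac:(by rewrite /warping_step eqxx ?orbT).
have s2 := stp (i, j) (i.+1, j.+1) ltac:(by rewrite /warping_step eqxx ?orbT).
have s3 := stp (i, j.+1) (i.+1, j.+1) ltac:(by rewrite /warping_step eqxx ?orbT).
rewrite /= in s1 s2 s3.
have h1 := IH i.+1 j ltac:(lia) ltac:(lia).
have h2 := IH i j ltac:(lia) ltac:(lia).
have [[i1 j1] st ->] := dtab_pred (alt b) g i.+3 j.+1 isT; rewrite P.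
case/or3P: st => /eqP[<- <-] /=; try lra.
(* The last step keeps the column, which may break the hypothesis. In that case the step before it
   is examined too, and nonnegative local costs are discarded. *)
have [le'|gt'] := leqP j.+1.*2 i.
  by have h3 := IH i j.+1 ltac:(lia) le'; lra.
have c1 := c0 i.+1 j.+1; have c2 := c0 i.+2 j.+1.
have [[i1' j1'] st ->] := dtab_pred (alt b) g i.+2 j.+1 isT.
by case/or3P: st => /eqP[<- <-] /=; lra.
Qed.

(** * Weakest preconditions with cost *)

Definition Var (v : nat) : expr := Read v (Const 0).

Definition Set_ (v : nat) (e : expr) : prog := Write v (Const 0) e.

Definition For (v : nat) (e : expr) (P : prog) : prog :=
  Seq (Set_ v (Const 0))
    (While (Test RLt (Var v) e) (Seq P (Set_ v (Op Add (Var v) (Const 1))))).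

Lemma eval_var s v : eval s (Var v) (s v 0%N).
Proof. exact: (@EvRead s v (Const 0) 0%N (EvConst s 0)). Qed.

Lemma eval_varn s v n : s v 0%N = n%:R -> eval s (Var v) n%:R.
Proof. by move=> <-; apply: eval_var. Qed.

Lemma eval_add s e1 e2 u v : eval s e1 u -> eval s e2 v ->
  eval s (Op Add e1 e2) (u + v).
Proof. by move=> H1 H2; apply: (@EvOp s Add e1 e2 u v H1 H2). Qed.

Lemma eval_sub s e1 e2 u v : eval s e1 u -> eval s e2 v ->
  eval s (Op Defs.Sub e1 e2) (u - v).
Proof. by move=> H1 H2; apply: (@EvOp s Defs.Sub e1 e2 u v H1 H2). Qed.

Lemma eval_mul s e1 e2 u v : eval s e1 u -> eval s e2 v ->
  eval s (Op Mul e1 e2) (u * v).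
Proof. by move=> H1 H2; apply: (@EvOp s Mul e1 e2 u v H1 H2). Qed.

Lemma eval_addn s e1 e2 (m n : nat) : eval s e1 m%:R -> eval s e2 n%:R ->
  eval s (Op Add e1 e2) (m + n)%N%:R.
Proof. by rewrite natrD; apply: eval_add. Qed.

Lemma eval_subn s e1 e2 (m n : nat) : (n <= m)%N ->
  eval s e1 m%:R -> eval s e2 n%:R -> eval s (Op Defs.Sub e1 e2) (m - n)%N%:R.
Proof. by move=> le; rewrite natrB //; apply: eval_sub. Qed.

Fixpoint reads (e : expr) : seq nat :=
  match e with
  | Const _ => [::]
  | Read a e => a :: reads e
  | Op _ e1 e2 => reads e1 ++ reads e2
  end.

Fixpoint writes (P : prog) : seq nat :=
  match P with
  | Skip => [::]
  | Write a _ _ => [:: a]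
  | Seq P Q | If _ P Q => writes P ++ writes Q
  | While _ P => writes P
  end.

(** Frames are per array, not per cell, so that non-interference is decided by computing
    [writes P]. *)
Definition frame (ws : seq nat) (s s' : store) : Prop :=
  forall a, a \notin ws -> s' a =1 s a.

Lemma frame_sub ws ws' s s' : {subset ws <= ws'} ->
  frame ws s s' -> frame ws' s s'.
Proof. by move=> sub F a na; apply: F; apply: contra na; apply: sub. Qed.

Lemma frame_trans ws s1 s2 s3 :
  frame ws s1 s2 -> frame ws s2 s3 -> frame ws s1 s3.
Proof. by move=> F G a na i; rewrite G // F. Qed.

Lemma frame_update s a i v : frame [:: a] s (update s a i v).
Proof. by move=> b; rewrite inE /update => /negbTE -> j. Qed.

Lemma eval_frame ws s s' e u : frame ws s s' -> ~~ has (mem ws) (reads e) ->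
  eval s e u -> eval s' e u.
Proof.
move=> F; elim: e u => [q|a e IH|o e1 IH1 e2 IH2] u /=.
- by move=> _ H; inversion H; constructor.
- rewrite negb_or => /andP[na nh] H; inversion H; subst.
  by rewrite -F //; constructor; apply: IH.
- rewrite has_cat negb_or => /andP[n1 n2] H; inversion H; subst.
  by constructor; [apply: IH1|apply: IH2|].
Qed.

Lemma exec_frame P s t s' : exec P s t s' -> frame (writes P) s s'.
Proof.
elim=> {P s t s'} //=.
- by move=> *; apply: frame_update.
- move=> s s1 s2 t1 t2 P Q _ F1 _ F2.
  apply: frame_trans (frame_sub _ _ _ _ _ F1) (frame_sub _ _ _ _ _ F2) => a;
  by rewrite mem_cat => ->; rewrite ?orbT.
- move=> s s1 t b r P Q _ _; apply: frame_sub => a.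
  by rewrite mem_cat; case: r => ->; rewrite ?orbT.
- by move=> s s1 s2 t1 t2 b P _ _ F1 _ F2; apply: frame_trans F1 F2.
Qed.

(** Total correctness within a budget. It also certifies that all addresses are natural numbers,
    since otherwise no [exec] derivation exists. *)
Definition wp (T : nat) (P : prog) (s : store) (Q : store -> Prop) : Prop :=
  exists t s', [/\ exec P s t s', (t <= T)%N & Q s'].

(** The frame is supplied by [exec_frame], so postconditions mention only what changes. *)
Lemma wp_mono T T' P s (Q Q' : store -> Prop) : (T <= T')%N ->
  (forall s', frame (writes P) s s' -> Q s' -> Q' s') ->
  wp T P s Q -> wp T' P s Q'.
Proof.
move=> leT QQ [t [s' [H le HQ]]]; exists t, s'; split => //.
  exact: leq_trans leT.
by apply: QQ => //; apply: exec_frame H.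
Qed.

Lemma wp_skip s (Q : store -> Prop) : Q s -> wp 0 Skip s Q.
Proof. by move=> HQ; exists 0%N, s; split => //; constructor. Qed.

Lemma wp_write a e1 e2 s i v (Q : store -> Prop) :
  eval s e1 i%:R -> eval s e2 v -> Q (update s a i v) ->
  wp (expr_ops e1 + expr_ops e2) (Write a e1 e2) s Q.
Proof.
by move=> H1 H2 HQ; eexists; exists (update s a i v); split; first exact: ExWrite.
Qed.

Lemma wp_set v e s u (Q : store -> Prop) :
  eval s e u -> Q (update s v 0 u) -> wp (expr_ops e) (Set_ v e) s Q.
Proof. exact: (wp_write v (Const 0) e s 0%N u Q (EvConst s 0)). Qed.

Lemma wp_seq T1 T2 P1 P2 s (Q : store -> Prop) :
  wp T1 P1 s (fun s1 => wp T2 P2 s1 Q) -> wp (T1 + T2) (Seq P1 P2) s Q.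
Proof.
move=> [t1 [s1 [H1 le1 [t2 [s2 [H2 le2 HQ]]]]]].
by exists (t1 + t2)%N, s2; split; [apply: ExSeq H1 H2|apply: leq_add|].
Qed.

Lemma wp_if T1 T2 c e1 e2 P1 P2 s u v (Q : store -> Prop) :
  eval s e1 u -> eval s e2 v ->
  (relop_val c u v -> wp T1 P1 s Q) ->
  (~~ relop_val c u v -> wp T2 P2 s Q) ->
  wp (test_ops (Test c e1 e2) + maxn T1 T2) (If (Test c e1 e2) P1 P2) s Q.
Proof.
move=> He1 He2 H1 H2; have Hb := EvTest c He1 He2.
have : wp (maxn T1 T2) (if relop_val c u v then P1 else P2) s Q.
  case: (relop_val c u v) H1 H2 => H1 H2.
    by apply: wp_mono (H1 isT) => //; apply: leq_maxl.
  by apply: wp_mono (H2 isT) => //; apply: leq_maxr.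
move=> [t [s1 [H le HQ]]]; eexists; exists s1; split; first exact: ExIf Hb H.
  by rewrite leq_add2l.
by [].
Qed.

(** The counter is rewritten between iterations, so the invariant must survive any write to [v]; the
    bound [e] is evaluated again at each test, so it may read neither [v] nor what the body writes.
    Since [0 < N], the final test of cost [(expr_ops e).+1] is charged to the iterations. *)
Lemma wp_for (I : nat -> store -> Prop) v e P (N T : nat) s0 :
  (0 < N)%N -> v \notin writes P -> ~~ has (mem (v :: writes P)) (reads e) ->
  eval s0 e N%:R ->
  (forall i s x, I i s -> I i (update s v 0 x)) ->
  I 0%N s0 ->
  (forall i s, (i < N)%N -> s v 0%N = i%:R -> frame (v :: writes P) s0 s ->
    I i s -> wp T P s (I i.+1)) ->
  wp ((T + expr_ops e * 2 + 3) * N) (For v e P) s0 (I N).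
Proof.
move=> N0 nv ne Ne stab I0 step.
have loop d i s : (i + d = N)%N -> s v 0%N = i%:R ->
    frame (v :: writes P) s0 s -> I i s ->
    wp ((T + expr_ops e + 2) * d + (expr_ops e).+1)
      (While (Test RLt (Var v) e) (Seq P (Set_ v (Op Add (Var v) (Const 1)))))
      s (I N).
  elim: d i s => [|d IH] i s eN si F Ii.
    exists (expr_ops e).+1, s; split; [|by lia|by rewrite -eN addn0].
    apply: ExWhileF; have -> : false = relop_val RLt (s v 0%N) N%:R.
      by rewrite si /= -eN addn0 ltxx.
    by constructor; [apply: eval_var|exact: eval_frame F ne Ne].
  have ltN : (i < N)%N by lia.
  have [t1 [s1 [H1 le1 I1]]] := step i s ltN si F Ii.
  have F1 := exec_frame _ _ _ _ H1.
  have s1i : s1 v 0%N = i%:R by rewrite F1.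
  pose s2 := update s1 v 0 (s1 v 0%N + 1).
  have H2 : exec (Set_ v (Op Add (Var v) (Const 1))) s1 1 s2.
    exact: (ExWrite v (EvConst s1 0%N%:R)
      (eval_add _ _ _ _ _ (eval_var _ _) (EvConst _ 1))).
  have [||||t3 [s3 [H3 le3 I3]]] := IH i.+1 s2.
  - by lia.
  - by rewrite /s2 /update !eqxx s1i natr1.
  - apply: frame_trans F _; apply: (@frame_trans _ _ s1).
      by apply: frame_sub F1 => a; rewrite inE orbC => ->.
    by apply: frame_sub (frame_update _ _ _ _) => a; rewrite !inE => ->.
  - exact: stab.
  exists ((expr_ops e).+1 + (t1 + 1) + t3)%N, s3; split => //; last by nia.
  apply: ExWhileT (ExSeq H1 H2) H3.
  have -> : true = relop_val RLt (s v 0%N) N%:R by rewrite si /= ltr_nat ltN.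
  by constructor; [apply: eval_var|exact: eval_frame F ne Ne].
pose s1 := update s0 v 0 0.
have F1 : frame (v :: writes P) s0 s1.
  by apply: frame_sub (frame_update _ _ _ _) => a; rewrite !inE => ->.
have s1v : s1 v 0%N = 0%:R by rewrite /s1 /update !eqxx.
have [t [s' [H le HN]]] := loop N 0%N s1 (add0n N) s1v F1 (stab _ _ _ I0).
exists (0 + t)%N, s'; split => //; last by nia.
apply: ExSeq H; exact: (ExWrite v (EvConst s0 0%N%:R) (EvConst s0 0)).
Qed.

(** * Filling a table *)

(* Only meaningful for programs without loops. *)
Fixpoint tmax (P : prog) : nat :=
  match P with
  | Skip => 0
  | Write _ e1 e2 => expr_ops e1 + expr_ops e2
  | Seq P Q => tmax P + tmax Q
  | If b P Q => test_ops b + maxn (tmax P) (tmax Q)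
  | While _ _ => 0
  end.

(* Array 0 holds the input and array 1 the output; tab is the dynamic
   programming table, acc b r the accumulated value of F_w at the alternating
   series of length r + 1 that starts with b.  The v* are scalars, kept in
   cell 0 of an array of their own. *)
Local Notation tab := 2%N (only parsing).
Local Notation acc b := (3 + nat_of_bool b)%N (only parsing).
Local Notation vP := 5%N (only parsing).
Local Notation vI := 6%N (only parsing).
Local Notation vN := 7%N (only parsing).
Local Notation vM := 8%N (only parsing).
Local Notation vW := 9%N (only parsing).
Local Notation vQ := 10%N (only parsing).
Local Notation vZ := 11%N (only parsing).
Local Notation vR := 12%N (only parsing).
Local Notation vJ := 13%N (only parsing).
Local Notation vT := 14%N (only parsing).
Local Notation vB := 15%N (only parsing).
Local Notation vL := 16%N (only parsing).

Definition relax (e : expr) : prog :=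
  If (Test RLt e (Var vT)) (Set_ vT e) Skip.

Lemma wp_relax e s u (Q : store -> Prop) : eval s e u ->
  (forall s', frame [:: vT] s s' -> s' vT 0%N = Order.min u (s vT 0%N) -> Q s') ->
  wp (tmax (relax e)) (relax e) s Q.
Proof.
move=> He HQ; apply: (wp_if _ _ _ _ _ _ _ _ _ _ _ He (eval_var _ _)) => /= c.
  apply: wp_set He _; apply: HQ; first exact: frame_update.
  by rewrite /update /= minElt c.
apply: wp_skip; apply: HQ => //.
by rewrite minElt (negbTE c).
Qed.

(** The tests on [vJ] and [vR] single out the borders of the table, where a neighbour is missing.
    The order of the two [relax] follows the bracketing of the minimum in [dtabSS]. *)
Definition fetch : prog :=
  If (Test RLt (Const 0) (Var vJ))
    (If (Test RLt (Const 0) (Var vR))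
      (Seq (Set_ vT (Read tab (Op Defs.Sub (Op Defs.Sub (Var vQ) (Var vM)) (Const 1))))
        (Seq (relax (Read tab (Op Defs.Sub (Var vQ) (Const 1))))
          (relax (Read tab (Op Defs.Sub (Var vQ) (Var vM))))))
      (Set_ vT (Read tab (Op Defs.Sub (Var vQ) (Const 1)))))
    (If (Test RLt (Const 0) (Var vR))
      (Set_ vT (Read tab (Op Defs.Sub (Var vQ) (Var vM))))
      (Set_ vT (Const 0))).

(** The block of a sample at address [vP] holds its weight, its length, then its values; hence the
    offset 2. *)
Definition cell : prog :=
  let d := Op Defs.Sub (Var vZ)
    (Read 0 (Op Add (Op Add (Var vP) (Const 2)) (Var vJ))) in
  Seq fetch
    (Seq (Write tab (Var vQ) (Op Add (Op Mul d d) (Var vT)))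
      (Set_ vQ (Op Add (Var vQ) (Const 1)))).

(* Row-major storage of [dtab f g], with rows of length [m], up to address [q]. *)
Definition tabulates f g (m q : nat) (s : store) : Prop :=
  forall l, (l < q)%N -> s tab l = dtab f g (l %/ m) (l %% m).

Lemma tabulatesE f g m q s r j l : tabulates f g m q s -> (j < m)%N ->
  l = (r * m + j)%N -> (l < q)%N -> s tab l = dtab f g r j.
Proof.
move=> H jm -> lt; rewrite H //.
by rewrite divnMDl ?divn_small ?addn0 ?modnMDl ?modn_small //; lia.
Qed.

Ltac evaln :=
  match goal with
  | |- eval _ (Op Add _ _) _ => apply: eval_addn; evaln
  | |- eval _ (Op Defs.Sub _ _) _ => apply: eval_subn; [|evaln|evaln]
  | |- eval _ (Var _) _ => apply: eval_varn; try eassumption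
  | |- eval _ (Const 0) _ => exact: (EvConst _ 0%N%:R)
  | |- eval _ (Const 1) _ => exact: (EvConst _ 1%N%:R)
  | |- eval _ (Const 2) _ => exact: (EvConst _ 2%N%:R)
  end.

Lemma wp_fetch f g (r j m : nat) s : (j < m)%N ->
  s vR 0%N = r%:R -> s vJ 0%N = j%:R -> s vM 0%N = m%:R ->
  s vQ 0%N = (r * m + j)%N%:R -> tabulates f g m (r * m + j) s ->
  wp (tmax fetch) fetch s
    (fun s' => (f r - g j) ^+ 2 + s' vT 0%N = dtab f g r j).
Proof.
move=> jm sR sJ sM sQ Ht.
apply: (wp_if _ _ _ _ _ _ _ _ _ _ _ (EvConst _ _) (eval_varn _ _ _ sJ)) => /=;
rewrite ltr0n => j0; apply: (wp_if _ _ _ _ _ _ _ _ _ _ _ (EvConst _ _) (eval_varn _ _ _ sR)) => /=;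
rewrite ltr0n => r0.
- case: r j => [|r] [|j] // in jm sR sJ sQ Ht r0 j0 *.
  apply: wp_seq.
  have E1 : eval s (Read tab
      (Op Defs.Sub (Op Defs.Sub (Var vQ) (Var vM)) (Const 1))) (dtab f g r j).
    rewrite -(tabulatesE _ _ _ _ _ r j (r.+1 * m + j.+1 - m - 1) Ht); try lia.
    by apply: EvRead; evaln; lia.
  apply: wp_set E1 _; set s1 := update _ _ _ _.
  apply: wp_seq.
  have E2 : eval s1 (Read tab (Op Defs.Sub (Var vQ) (Const 1))) (dtab f g r.+1 j).
    rewrite -(tabulatesE _ _ _ _ _ r.+1 j (r.+1 * m + j.+1 - 1) Ht); try lia.
    by apply: (@EvRead s1); evaln; lia.
  apply: wp_relax E2 _ => s2 F2 s2T.
  have [s2Q s2M] : s2 vQ 0%N = (r.+1 * m + j.+1)%N%:R /\ s2 vM 0%N = m%:R.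
    by rewrite !F2.
  have E3 : eval s2 (Read tab (Op Defs.Sub (Var vQ) (Var vM))) (dtab f g r j.+1).
    rewrite -(tabulatesE _ _ _ _ _ r j.+1 (r.+1 * m + j.+1 - m) Ht); try lia.
    rewrite -[s tab _]/(s1 tab _) -F2 //.
    by apply: EvRead; evaln; lia.
  apply: wp_relax E3 _ => s3 F3 ->.
  by rewrite dtabSS s2T.
- case: r j => [|r] [|j] // in jm sR sJ sQ Ht r0 j0 *.
  have E1 : eval s (Read tab (Op Defs.Sub (Var vQ) (Const 1))) (dtab f g 0 j).
    rewrite -(tabulatesE _ _ _ _ _ 0 j (0 * m + j.+1 - 1) Ht); try lia.
    by apply: EvRead; evaln; lia.
  by apply: wp_set E1 _; rewrite /update /= dtab0S.
- case: r j => [|r] [|j] // in jm sR sJ sQ Ht r0 j0 *.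
  have E1 : eval s (Read tab (Op Defs.Sub (Var vQ) (Var vM))) (dtab f g r 0).
    rewrite -(tabulatesE _ _ _ _ _ r 0 (r.+1 * m + 0 - m) Ht); try lia.
    by apply: EvRead; evaln; lia.
  by apply: wp_set E1 _; rewrite /update /= dtabS0.
- case: r j => [|r] [|j] // in jm sR sJ sQ Ht r0 j0 *.
  by apply: (wp_set _ _ _ _ _ (EvConst _ _)); rewrite /update /= dtab00 addr0.
Qed.

Lemma wp_cell f g (r j m p : nat) s : (j < m)%N ->
  s vR 0%N = r%:R -> s vJ 0%N = j%:R -> s vM 0%N = m%:R -> s vP 0%N = p%:R ->
  s vQ 0%N = (r * m + j)%N%:R -> s vZ 0%N = f r -> s 0%N (p + 2 + j)%N = g j ->
  tabulates f g m (r * m + j) s ->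
  wp (tmax cell) cell s (fun s' => s' vQ 0%N = (r * m + j).+1%:R /\
    tabulates f g m (r * m + j).+1 s').
Proof.
move=> jm sR sJ sM sP sQ sZ sX Ht.
apply: wp_seq; apply: wp_mono (wp_fetch f g r j m s jm sR sJ sM sQ Ht) => //.
move=> s1 F1 s1T; apply: wp_seq.
have s1Q : s1 vQ 0%N = (r * m + j)%N%:R by rewrite F1.
have s1P : s1 vP 0%N = p%:R by rewrite F1.
have s1J : s1 vJ 0%N = j%:R by rewrite F1.
have E : eval s1 (Op Defs.Sub (Var vZ)
    (Read 0 (Op Add (Op Add (Var vP) (Const 2)) (Var vJ)))) (f r - g j).
  rewrite -sZ -sX -!F1 //.
  by apply: eval_sub; [exact: eval_var|apply: EvRead; evaln].
have := eval_add _ _ _ _ _ (eval_mul _ _ _ _ _ E E) (eval_var s1 vT).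
rewrite -expr2 s1T => {}E.
apply: (wp_write _ _ _ _ _ _ _ (eval_varn _ _ _ s1Q) E).
set s2 := update _ _ _ _.
apply: wp_set (eval_add _ _ _ _ _ (eval_var _ _) (EvConst _ _)) _.
split; first by rewrite /s2 /update /= s1Q natr1.
move=> l; rewrite ltnS leq_eqVlt /s2 /update /=.
case: eqVneq => [->|ne] /=.
  by rewrite divnMDl ?divn_small ?addn0 ?modnMDl ?modn_small //; lia.
by move=> lt; rewrite F1 //; apply: Ht.
Qed.

(** After a row, [vQ - 1] addresses its last column: the squared distance from the prefix of length
    [vR + 1] to the sample. *)
Definition row_end (b : bool) : prog :=
  Seq (Write (acc b) (Var vR) (Op Add (Read (acc b) (Var vR))
        (Op Mul (Var vW) (Read tab (Op Defs.Sub (Var vQ) (Const 1))))))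
    (Set_ vZ (Op Defs.Sub (Const 1) (Var vZ))).

Definition row (b : bool) : prog := Seq (For vJ (Var vM) cell) (row_end b).

Lemma wp_row : exists K, forall (b : bool) g (r m p : nat) w s, (0 < m)%N ->
  s vR 0%N = r%:R -> s vM 0%N = m%:R -> s vP 0%N = p%:R -> s vW 0%N = w ->
  s vQ 0%N = (r * m)%N%:R -> s vZ 0%N = alt b r ->
  (forall j, (j < m)%N -> s 0%N (p + 2 + j)%N = g j) ->
  tabulates (alt b) g m (r * m) s ->
  wp (K * m) (row b) s (fun s' =>
    [/\ s' vQ 0%N = (r.+1 * m)%N%:R, s' vZ 0%N = alt b r.+1,
      tabulates (alt b) g m (r.+1 * m) s' &
      forall l, s' (acc b) l = s (acc b) l +
        (if l == r then w * dtab (alt b) g r m.-1 else 0)]).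
Proof.
exists (tmax cell + 3 + tmax (row_end false))%N => b g r m p w s m0 sR sM sP sW sQ sZ sX Ht.
pose I j (s' : store) := s' vQ 0%N = (r * m + j)%N%:R /\
  tabulates (alt b) g m (r * m + j) s'.
apply: (wp_mono ((tmax cell + 3) * m + tmax (row_end b)) _ _ _ _ _ _ (fun _ _ => id)).
  (* The cost does not depend on which accumulator is used, so the two sides are convertible and one
     constant serves both values of [b]. *)
  by rewrite -[tmax (row_end b)]/(tmax (row_end false)) [leqRHS]mulnDl leq_add2l leq_pmulr.
apply: wp_seq.
have HI : wp ((tmax cell + 0 * 2 + 3) * m) (For vJ (Var vM) cell) s (I m).
  apply: wp_for => //.
  - exact: eval_varn.
  - by split; rewrite addn0.
  - move=> j s1 jm s1J F1 [s1Q s1t].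
    have F v : v \notin vJ :: writes cell -> s1 v =1 s v by apply: F1.
    rewrite /I addnS.
    by apply: (wp_cell (alt b) g r j m p) => //; rewrite F // sX.
rewrite addn0 in HI; apply: wp_mono HI => // s1 F1 [s1Q s1t].
have m0' : (r * m + m)%N = (r.+1 * m)%N by rewrite mulSn addnC.
rewrite m0' in s1Q s1t.
apply: wp_seq.
have E1 : eval s1 (Read tab (Op Defs.Sub (Var vQ) (Const 1))) (dtab (alt b) g r m.-1).
  rewrite -(tabulatesE _ _ _ _ _ r m.-1 (r.+1 * m - 1) s1t); try lia.
  by apply: EvRead; evaln; lia.
have s1R : s1 vR 0%N = r%:R by rewrite F1.
have E2 := eval_add _ _ _ _ _ (EvRead (acc b) (eval_varn _ _ _ s1R))
  (eval_mul _ _ _ _ _ (eval_var _ vW) E1).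
apply: (wp_write _ _ _ _ _ _ _ (eval_varn _ _ _ s1R) E2).
apply: (wp_set _ _ _ _ _ (eval_sub _ _ _ _ _ (EvConst _ 1) (eval_var _ _))).
have Fb : s1 (acc b) =1 s (acc b) by apply: F1; case: (b).
split.
- by rewrite -s1Q; case: (b).
- by rewrite -altS -sZ -F1 //; case: (b).
- by move=> l lt; rewrite -s1t //; case: (b).
- move=> l; rewrite -!Fb -sW -F1 //.
  rewrite /update /=; case: (b); rewrite /= ?add0n ?addn0;
  by case: eqVneq => [->|_]; rewrite ?addr0.
Qed.

Definition sample (b : bool) : prog :=
  Seq (Seq (Set_ vW (Read 0 (Var vP)))
    (Seq (Set_ vM (Read 0 (Op Add (Var vP) (Const 1))))
    (Seq (Set_ vQ (Const 0)) (Set_ vZ (Const b%:R)))))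
  (Seq (For vR (Op Add (Var vN) (Var vN)) (row b))
    (Set_ vP (Op Add (Op Add (Var vP) (Var vM)) (Const 2)))).

Lemma wp_sample : exists K, forall (b : bool) g (m n p : nat) w s,
  (0 < m)%N -> (m <= n)%N ->
  s vN 0%N = n%:R -> s vP 0%N = p%:R -> s 0%N p = w -> s 0%N (p + 1)%N = m%:R ->
  (forall j, (j < m)%N -> s 0%N (p + 2 + j)%N = g j) ->
  wp (K * n ^ 2) (sample b) s (fun s' : store => s' vP 0%N = (p + m + 2)%N%:R /\
      forall l, s' (acc b) l = s (acc b) l +
        (if (l < n + n)%N then w * dtab (alt b) g l m.-1 else 0)).
Proof.
have [K HK] := wp_row.
(* [tmax] counts loops as 0, so its value here is the cost outside the loop; the factor 2 stems from
   the [n + n] rows. *)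
exists (tmax (sample false) + (K + 5) * 2)%N => b g m n p w s m0 mn sN sP s0 s1 sX.
pose T0 := tmax (Seq (Set_ vW (Read 0 (Var vP)))
    (Seq (Set_ vM (Read 0 (Op Add (Var vP) (Const 1))))
    (Seq (Set_ vQ (Const 0)) (Set_ vZ (Const b%:R))))).
apply: (wp_mono (T0 + ((K * m + 1 * 2 + 3) * (n + n) + 2)) _ _ _ _ _ _ (fun _ _ => id)).
  by rewrite /T0 /=; nia.
apply: wp_seq.
apply: wp_seq; apply: (wp_set _ _ _ _ _ (EvRead 0 (eval_varn _ _ _ sP))).
set s1' := update _ _ _ _.
apply: wp_seq.
have E1 : eval s1' (Read 0 (Op Add (Var vP) (Const 1))) m%:R.
  by rewrite -s1 -[s _ _]/(s1' 0%N (p + 1)%N); apply: EvRead; evaln.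
apply: (wp_set _ _ _ _ _ E1).
apply: wp_seq; apply: (wp_set _ _ _ _ _ (EvConst _ _)).
apply: (wp_set _ _ _ _ _ (EvConst _ _)).
set s2 := update _ _ _ _.
(* At [r = 0] the clause on the table is vacuous, so entries left by the previous sample are
   harmless and nothing has to be cleared. *)
pose I r (s' : store) := [/\ s' vQ 0%N = (r * m)%N%:R, s' vZ 0%N = alt b r,
  tabulates (alt b) g m (r * m) s' &
  forall l, s' (acc b) l = s (acc b) l +
    (if (l < r)%N then w * dtab (alt b) g l m.-1 else 0)].
have HI : wp ((K * m + 1 * 2 + 3) * (n + n))
    (For vR (Op Add (Var vN) (Var vN)) (row b)) s2 (I (n + n)%N).
  apply: wp_for.
  - by lia.
  - by case: (b).
  - by case: (b).
  - by evaln.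
  - by move=> r s3 x [? ? ? Ha]; split => // l; rewrite -Ha; case: (b).
  - split.
    + by [].
    + by rewrite /alt addbF.
    + by [].
    + by move=> l; rewrite addr0; case: (b).
  - move=> r s3 rlt s3R F3 [s3Q s3Z s3t s3a].
    (* With [b] a variable, [writes (row b)] does not compute; testing both values does. *)
    have F v : (v \notin vR :: writes (row false)) &&
        (v \notin vR :: writes (row true)) -> s3 v =1 s2 v.
      by case/andP=> nf nt; apply: F3; case: (b).
    have H := HK b g r m p w s3 m0 s3R.
    apply: wp_mono (H _ _ _ s3Q s3Z _ s3t) => //.
    + move=> s4 _ [s4Q s4Z s4t s4a]; split => // l.
      rewrite s4a s3a -addrA; congr (_ + _).
      rewrite ltnS; case: (ltngtP l r) => [lt|gt|->]; rewrite ?ltnn ?addr0 ?add0r //.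
    + by rewrite F.
    + by rewrite F.
    + by rewrite F.
    + by move=> j jm; rewrite -sX // F.
apply: wp_seq; apply: wp_mono HI => // s3 F3 [s3Q s3Z s3t s3a].
have F v : (v \notin vR :: writes (row false) ++ [:: vR]) &&
    (v \notin vR :: writes (row true) ++ [:: vR]) -> s3 v =1 s2 v.
  by case/andP=> nf nt; apply: F3; case: (b).
have s3P : s3 vP 0%N = p%:R by rewrite F.
have s3M : s3 vM 0%N = m%:R by rewrite F.
have E : eval s3 (Op Add (Op Add (Var vP) (Var vM)) (Const 2)) (p + m + 2)%N%:R.
  by evaln.
apply: (wp_set _ _ _ _ _ E); split => // l.
by rewrite -s3a; case: (b).
Qed.

(** * The program *)

(** The leading 1 skips the cell of [k]; the 2 counts the weight and the length of each sample. *)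
Definition offset (X : nat -> seq rat) (i : nat) : nat :=
  (1 + \sum_(i' < i) (size (X i') + 2))%N.

Lemma offsetS X i : offset X i.+1 = (offset X i + size (X i) + 2)%N.
Proof. by rewrite /offset big_ord_recr /= -!addnA. Qed.

Definition holds_input (k : nat) (X : nat -> seq rat) (W : nat -> rat)
    (c : nat -> rat) : Prop :=
  c 0%N = k%:R /\ forall i, (i < k)%N ->
    [/\ c (offset X i) = W i, c (offset X i + 1)%N = (size (X i))%:R &
      forall j, (j < size (X i))%N -> c (offset X i + 2 + j)%N = nth 0 (X i) j].

Definition weighted_dtab (k : nat) (X : nat -> seq rat) (W : nat -> rat)
    (b : bool) (l : nat) : rat :=
  \sum_(i < k) W i * dtab (alt b) (nth 0 (X i)) l (size (X i)).-1.

Definition accum (b : bool) : prog :=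
  Seq (Set_ vP (Const 1)) (For vI (Read 0 (Const 0)) (sample b)).

Lemma eval_read0 s k : s 0%N 0%N = k%:R -> eval s (Read 0 (Const 0)) k%:R.
Proof. by move=> <-; apply: (@EvRead s 0 (Const 0) 0%N); apply: EvConst. Qed.

Lemma wp_accum : exists K, forall b k X W n s, (0 < k)%N ->
  (forall i, (i < k)%N -> (0 < size (X i) <= n)%N) ->
  holds_input k X W (s 0%N) -> s vN 0%N = n%:R -> (forall l, s (acc b) l = 0) ->
  wp (K * (k * n ^ 2)) (accum b) s (fun s' => forall l, (l < n + n)%N ->
    s' (acc b) l = weighted_dtab k X W b l).
Proof.
have [K HK] := wp_sample; exists (K + 3)%N => b k X W n s k0 HX [s0 sI] sN sA.
have n0 : (0 < n)%N by have /andP[] := HX 0%N k0; apply: leq_trans.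
apply: (wp_mono (0 + (K * n ^ 2 + 0 * 2 + 3) * k) _ _ _ _ _ _ (fun _ _ => id)).
  by have : (0 < n ^ 2)%N; [rewrite expn_gt0 n0|nia].
apply: wp_seq; apply: (wp_set _ _ _ _ _ (EvConst _ _)).
set s1 := update _ _ _ _.
pose I i (s' : store) := s' vP 0%N = (offset X i)%:R /\
  forall l, (l < n + n)%N -> s' (acc b) l = weighted_dtab i X W b l.
suff : wp ((K * n ^ 2 + 0 * 2 + 3) * k)
    (For vI (Read 0 (Const 0)) (sample b)) s1 (I k).
  by apply: wp_mono => // s2 _ [].
apply: wp_for => //.
- by case: (b).
- exact: eval_read0.
- by move=> i s2 x [? Ha]; split => // l /Ha <-; case: (b).
- split; first by rewrite /offset big_ord0.
  by move=> l _; rewrite /weighted_dtab big_ord0 -(sA l); case: (b).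
- move=> i s2 ik s2I F2 [s2P s2A].
  have F v : (v \notin vI :: writes (sample false)) &&
      (v \notin vI :: writes (sample true)) -> s2 v =1 s1 v.
    by case/andP=> nf nt; apply: F2; case: (b).
  have [iw im ix] := sI i ik; have /andP[m0 mn] := HX i ik.
  have := HK b (nth 0 (X i)) (size (X i)) n (offset X i) (W i) s2 m0 mn.
  rewrite !(F 0%N) // (F vN) // => H.
  apply: wp_mono (H sN s2P iw im _) => //; last by move=> j jm; rewrite F // -ix.
  move=> s3 _ [s3P s3A]; split; first by rewrite offsetS.
  move=> l ln; rewrite s3A ln s2A //.
  by rewrite /weighted_dtab big_ord_recr.
Qed.

Definition maxlen_step : prog :=
  Seq (Set_ vM (Read 0 (Op Add (Var vP) (Const 1))))
  (Seq (If (Test RLt (Var vN) (Var vM)) (Set_ vN (Var vM)) Skip)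
    (Set_ vP (Op Add (Op Add (Var vP) (Var vM)) (Const 2)))).

Definition maxlen : prog :=
  Seq (Set_ vP (Const 1)) (For vI (Read 0 (Const 0)) maxlen_step).

Lemma wp_maxlen : exists K, forall k X W s, (0 < k)%N ->
  holds_input k X W (s 0%N) -> s vN 0%N = 0 ->
  wp (K * k) maxlen s
    (fun s' => s' vN 0%N = (\max_(i < k) size (X i))%N%:R).
Proof.
exists (tmax maxlen_step + 0 * 2 + 3)%N => k X W s k0 [s0 sI] sN.
rewrite -[(_ * k)%N]add0n; apply: wp_seq.
apply: (wp_set _ _ _ _ _ (EvConst _ _)).
set s1 := update _ _ _ _.
pose I i (s' : store) := s' vP 0%N = (offset X i)%:R /\
  s' vN 0%N = (\max_(i' < i) size (X i'))%N%:R.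
suff : wp ((tmax maxlen_step + 0 * 2 + 3) * k)
    (For vI (Read 0 (Const 0)) maxlen_step) s1 (I k).
  by apply: wp_mono => // s2 _ [].
apply: wp_for => //.
- exact: eval_read0.
- by split; rewrite /offset big_ord0.
- move=> i s2 ik s2I F2 [s2P s2N]; have [_ im _] := sI i ik.
  apply: wp_seq.
  have E1 : eval s2 (Read 0 (Op Add (Var vP) (Const 1))) (size (X i))%:R.
    rewrite -im -[s 0%N _]/(s1 0%N _) -F2 //; apply: EvRead.
    by evaln.
  apply: wp_set E1 _; set s3 := update _ _ _ _.
  have s3N : s3 vN 0%N = s2 vN 0%N by [].
  have s3M : s3 vM 0%N = (size (X i))%:R by [].
  have s3P : s3 vP 0%N = (offset X i)%:R by [].
  apply: wp_seq; rewrite s2N in s3N.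
  apply: (wp_mono _ _ _ _ (fun s' : store => s' vP 0%N = (offset X i)%:R /\
    s' vM 0%N = (size (X i))%:R /\
    s' vN 0%N = (\max_(i' < i.+1) size (X i'))%N%:R) _ (leqnn _)); last first.
    apply: (wp_if _ _ _ _ _ _ _ _ _ _ _ (eval_varn _ _ _ s3N) (eval_varn _ _ _ s3M)) => /=;
    rewrite ltr_nat => lt.
      apply: (wp_set _ _ _ _ _ (eval_varn _ _ _ s3M)); split => //; split => //.
      by rewrite big_ord_recr /= (maxn_idPr (ltnW lt)).
    apply: wp_skip; split => //; split => //.
    by rewrite big_ord_recr /= (maxn_idPl _) // leqNgt.
  move=> s4 _ [s4P [s4M s4N]].
  have E : eval s4 (Op Add (Op Add (Var vP) (Var vM)) (Const 2))
      (offset X i + size (X i) + 2)%N%:R by evaln.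
  by apply: wp_set E _; split => //; rewrite offsetS.
Qed.

(** * Choosing the best candidate and writing it out *)

Definition pick_min (b : bool) : prog :=
  If (Test RLt (Read (acc b) (Var vR)) (Var vT))
    (Seq (Set_ vT (Read (acc b) (Var vR)))
      (Seq (Set_ vB (Const b%:R)) (Set_ vL (Var vR)))) Skip.

(** The current best need not lie in the set [S] of examined candidates, so the search can start
    with [S] empty and an arbitrary candidate. *)
Definition minimal (A : bool -> nat -> rat) (n : nat) (S : bool -> nat -> Prop)
    (s : store) : Prop :=
  (exists (b : bool) l, [/\ (l < n)%N, s vB 0%N = b%:R, s vL 0%N = l%:R &
    s vT 0%N = A b l]) /\
  forall b l, S b l -> s vT 0%N <= A b l.

Lemma wp_pick_min (A : bool -> nat -> rat) n (S : bool -> nat -> Prop) (b : bool) r s :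
  (r < n)%N -> s vR 0%N = r%:R -> s (acc b) r = A b r -> minimal A n S s ->
  wp (tmax (pick_min b)) (pick_min b) s
    (minimal A n (fun b' l => S b' l \/ (b' = b /\ l = r))).
Proof.
move=> rn sR sA [Hex Hmin].
have E : eval s (Read (acc b) (Var vR)) (A b r).
  by rewrite -sA; apply: EvRead; evaln.
apply: (wp_if _ _ _ _ _ _ _ _ _ _ _ E (eval_var _ _)) => /= c; last first.
  apply: wp_skip; split => // b' l [/Hmin //|[-> ->]].
  by rewrite leNgt.
apply: wp_seq; apply: wp_set E _; set s1 := update _ _ _ _.
have s1R : s1 vR 0%N = r%:R by [].
apply: wp_seq; apply: (wp_set _ _ _ _ _ (EvConst _ _)).
apply: (wp_set _ _ _ _ _ (eval_varn _ _ r%N _)) => //.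
split; first by exists b, r.
by move=> b' l /= [/Hmin /(lt_le_trans c)/ltW //|[-> ->]].
Qed.

Definition select : prog :=
  Seq (Seq (Set_ vT (Read (acc false) (Const 0)))
    (Seq (Set_ vB (Const 0)) (Set_ vL (Const 0))))
  (For vR (Op Add (Var vN) (Var vN)) (Seq (pick_min false) (pick_min true))).

Lemma wp_select : exists K, forall (A : bool -> nat -> rat) n s, (0 < n)%N ->
  s vN 0%N = n%:R ->
  (forall b l, (l < n + n)%N -> s (acc b) l = A b l) ->
  wp (K * n) select s (minimal A (n + n) (fun b l => (l < n + n)%N)).
Proof.
pose T := tmax (Seq (pick_min false) (pick_min true)).
exists ((T + 1 * 2 + 3) * 2)%N => A n s n0 sN sA.
apply: (wp_mono (0 + (0 + 0) + (T + 1 * 2 + 3) * (n + n)) _ _ _ _ _ _ (fun _ _ => id)).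
  by nia.
apply: wp_seq.
have E : eval s (Read (acc false) (Const 0)) (s (acc false) 0%N).
  by apply: (@EvRead s); apply: (EvConst _ 0%N%:R).
apply: wp_seq; apply: wp_set E _.
apply: wp_seq; apply: (wp_set _ _ _ _ _ (EvConst _ _)).
apply: (wp_set _ _ _ _ _ (EvConst _ _)); set s1 := update _ _ _ _.
apply: (wp_for (fun r => minimal A (n + n) (fun b l => (l < r)%N))) => //.
- by lia.
- by evaln.
- split=> //; exists false, 0%N; split => //; first by lia.
  by rewrite -sA //; lia.
- move=> r s2 rn s2R F2 H; apply: wp_seq.
  have E1 : s2 (acc false) r = A false r by rewrite F2 //; apply: sA.
  apply: wp_mono (wp_pick_min _ _ _ _ _ _ rn s2R E1 H) => // s3 F3 H3.
  have E2 : s3 (acc true) r = A true r by rewrite F3 // F2 //; apply: sA.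
  have s3R : s3 vR 0%N = r%:R by rewrite F3.
  apply: wp_mono (wp_pick_min _ _ _ _ _ _ rn s3R E2 H3) => // s4 _ [H4 M].
  split=> // b l; rewrite ltnS leq_eqVlt => /orP[/eqP ->|lt].
    by apply: M; case: b; tauto.
  by apply: M; left; left.
Qed.

(** Values are shifted by one because cell 0 of the output holds the length. *)
Definition emit : prog :=
  Seq (Write 1 (Op Add (Var vR) (Const 1)) (Var vZ))
    (Set_ vZ (Op Defs.Sub (Const 1) (Var vZ))).

Definition output : prog :=
  Seq (Seq (Write 1 (Const 0) (Op Add (Var vL) (Const 1))) (Set_ vZ (Var vB)))
    (For vR (Op Add (Var vL) (Const 1)) emit).

Lemma wp_output : exists K, forall (b : bool) (l : nat) s,
  s vB 0%N = b%:R -> s vL 0%N = l%:R ->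
  wp (K * l.+1) output s
    (fun s' => holds_output s' (encode_series (mkseq (alt b) l.+1))).
Proof.
exists (1 + (tmax emit + 1 * 2 + 3))%N => b l s sB sL.
apply: (wp_mono (0 + 1 + 0 + (tmax emit + 1 * 2 + 3) * l.+1) _ _ _ _ _ _ (fun _ _ => id)).
  by nia.
apply: wp_seq; apply: wp_seq.
have E : eval s (Op Add (Var vL) (Const 1)) (l + 1)%N%:R by evaln.
apply: (wp_write _ _ _ _ _ _ _ (EvConst _ 0%N%:R) E).
apply: (wp_set _ _ _ _ _ (eval_var _ _)); set s1 := update _ _ _ _.
pose I i (s' : store) := [/\ s' vZ 0%N = alt b i, s' 1%N 0%N = l.+1%:R &
  forall j, (j < i)%N -> s' 1%N j.+1 = alt b j].
suff : wp ((tmax emit + 1 * 2 + 3) * l.+1)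
    (For vR (Op Add (Var vL) (Const 1)) emit) s1 (I l.+1).
  apply: wp_mono => // s2 _ [_ s20 s2S] i.
  have := @nth_mkseq _ 0 (alt b) l.+1; have := size_mkseq (alt b) l.+1.
  rewrite /encode_series; move: (mkseq _ _) => q sq nq; rewrite sq.
  by case: i => [|i] //=; rewrite sq ltnS => lt; rewrite s2S ?nq.
apply: wp_for => //.
- by rewrite -(addn1 l); evaln.
- split => //; first by rewrite /alt addbF.
  by rewrite /s1 /update /= addn1.
- move=> i s2 il s2R F2 [s2Z s20 s2S].
  have E1 : eval s2 (Op Add (Var vR) (Const 1)) (i + 1)%N%:R by evaln.
  apply: wp_seq; apply: (wp_write _ _ _ _ _ _ _ E1 (eval_var _ _)).
  apply: (wp_set _ _ _ _ _ (eval_sub _ _ _ _ _ (EvConst _ 1) (eval_var _ _))).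
  split.
  + by rewrite -altS -s2Z.
  + by rewrite /update /= addn1.
  + move=> j; rewrite ltnS leq_eqVlt /update /= addn1 eqSS.
    by case: eqVneq => [-> _|_ /= /s2S].
Qed.

(** * Correctness *)

(** One [l'] must serve all [g], because the same candidate is compared with every sample. From
    [n + n] on, every column [j < n] satisfies the hypothesis of [dtab_alt_shrink]. *)
Lemma alt_bounded b n l : (0 < n)%N -> exists2 l', (l' < n + n)%N &
  forall g j, (j < n)%N -> dtab (alt b) g l' j <= dtab (alt b) g l j.
Proof.
move=> n0; have [m] := ubnP l; elim: m l => // m IH l lm.
have [lt|ge] := ltnP l (n + n); first by exists l.
case: l => [|[|l]] in lm ge *; [lia|lia|].
have [l' lt' Hl'] := IH l ltac:(lia); exists l' => // g j jn.
by apply: le_trans (Hl' g j jn) _; apply: dtab_alt_shrink; lia.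
Qed.

Lemma nth_flatten_mkseq (f : nat -> seq rat) k i j :
  (i < k)%N -> (j < size (f i))%N ->
  nth 0 (flatten (mkseq f k)) (\sum_(i' < i) size (f i') + j) = nth 0 (f i) j.
Proof.
have mkseqSl (h : nat -> seq rat) m : mkseq h m.+1 = h 0%N :: mkseq (h \o S) m.
  by rewrite /mkseq /= -[1%N]/(1 + 0)%N iotaDl -map_comp.
elim: i f k => [|i IH] f [|k] // ik ji; rewrite mkseqSl /= nth_cat.
  by rewrite big_ord0 add0n ji.
rewrite big_ord_recl -addnA ltnNge leq_addr /= addKn.
exact: (IH (f \o S)).
Qed.

(** Families over ['I_k] become functions on [nat], so that loop invariants can sum over the first
    [i] samples. *)
Definition extend T (d : T) k (x : 'I_k -> T) (i : nat) : T :=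
  if insub i is Some o then x o else d.

Lemma extendE T (d : T) k (x : 'I_k -> T) (i : 'I_k) : extend T d k x i = x i.
Proof. by rewrite /extend valK. Qed.

Lemma holds_input_load k (x : 'I_k -> seq rat) (w : 'I_k -> rat) :
  holds_input k (extend _ [::] k x) (extend _ 0 k w)
    (load (encode_sample x w) 0%N).
Proof.
set X := extend _ _ _ x; set W := extend _ _ _ w.
pose f i := W i :: encode_series (X i).
have -> : encode_sample x w = k%:R :: flatten (mkseq f k).
  congr (_ :: flatten _); rewrite /mkseq -val_enum_ord -map_comp.
  by apply: eq_map => i; rewrite /f /= /X /W !extendE.
have nthf i j : (i < k)%N -> (j < (size (X i)).+2)%N ->
    nth 0 (k%:R :: flatten (mkseq f k)) (offset X i + j) = nth 0 (f i) j.
  move=> ik jX; rewrite -(nth_flatten_mkseq f k) // -addnA add1n /=.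
  by congr (nth 0 _ (_ + _)%N); apply: eq_bigr => i' _; rewrite /= addn2.
split=> // i ik; rewrite /load eqxx; split.
- by rewrite -[offset X i]addn0 nthf.
- by rewrite nthf.
- by move=> j jX; rewrite -addnA nthf.
Qed.

Lemma binary_alt b l : binary_series (mkseq (alt b) l.+1).
Proof.
apply/andP; split; first by rewrite -size_eq0 size_mkseq.
by apply/allP => _ /mapP[i _ ->]; rewrite /alt; case: (_ (+) _); rewrite eqxx ?orbT.
Qed.

Lemma frechet_dtab (R : realType) k (x : 'I_k -> seq rat) (w : 'I_k -> rat) z :
  (forall i, binary_series (x i)) -> binary_series z ->
  frechet R x w z = ratr (\sum_(i < k) w i *
    dtab (nth 0 z) (nth 0 (x i)) (size z).-1 (size (x i)).-1).
Proof.
move=> Hx /andP[z0 _]; rewrite rmorph_sum; apply: eq_bigr => i _ /=.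
by rewrite rmorphM /= dtw_sqr //; have /andP[] := Hx i.
Qed.

Definition binary_dtw_mean : prog :=
  Seq maxlen (Seq (accum false) (Seq (accum true) (Seq select output))).

Lemma wp_binary_dtw_mean : exists K, forall k (X : nat -> seq rat) W s,
  let n := (\max_(i < k) size (X i))%N in
  (0 < k)%N -> (forall i, (i < k)%N -> (0 < size (X i))%N) ->
  holds_input k X W (s 0%N) -> (forall a i, a != 0%N -> s a i = 0) ->
  wp (K * (k * n ^ 3)) binary_dtw_mean s (fun s' => exists b l,
    holds_output s' (encode_series (mkseq (alt b) l.+1)) /\
    forall b' l', (l' < n + n)%N ->
      weighted_dtab k X W b l <= weighted_dtab k X W b' l').
Proof.
have [K1 H1] := wp_maxlen; have [K2 H2] := wp_accum.
have [K3 H3] := wp_select; have [K4 H4] := wp_output.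
(* The factor 2 pays for the output, whose length [l.+1] is at most [n + n]. *)
exists (K1 + (K2 + (K2 + (K3 + K4 * 2))))%N => k X W s n k0 HX sI s0.
have Xn i : (i < k)%N -> (0 < size (X i) <= n)%N.
  move=> ik; rewrite HX //=.
  exact: (@leq_bigmax _ (fun i : 'I_k => size (X i)) (Ordinal ik)).
have n0 : (0 < n)%N by have /andP[] := Xn 0%N k0; apply: leq_trans.
have nn2 : (n <= n ^ 2)%N by rewrite -[leqLHS]expn1 leq_pexp2l.
have nn3 : (n ^ 2 <= n ^ 3)%N by rewrite leq_pexp2l.
have n30 : (0 < n ^ 3)%N by rewrite expn_gt0 n0.
apply: (wp_mono (K1 * k + (K2 * (k * n ^ 2) +
    (K2 * (k * n ^ 2) + (K3 * n + K4 * (n + n))))) _ _ _ _ _ _ (fun _ _ => id)).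
  rewrite !mulnDl -mulnA; do ![apply: leq_add]; rewrite leq_mul //; nia.
apply: wp_seq; apply: wp_mono (H1 k X W s k0 sI (s0 vN 0%N isT)) => // s1 F1 s1N.
apply: wp_seq.
have s10 : holds_input k X W (s1 0%N).
  by case: sI => ? sI; split=> [|i /sI[? ? Hj]]; rewrite ?F1 //; split => // j;
    rewrite F1 //; apply: Hj.
have A1 l : s1 3%N l = 0 by rewrite F1 // s0.
apply: wp_mono (H2 false k X W n s1 k0 Xn s10 s1N A1) => // s2 F2 s2A.
have s20 : holds_input k X W (s2 0%N).
  by case: s10 => ? sI'; split=> [|i /sI'[? ? Hj]]; rewrite ?F2 //; split => // j;
    rewrite F2 //; apply: Hj.
have s2N : s2 vN 0%N = n%:R by rewrite F2.
have A2 l : s2 4%N l = 0 by rewrite F2 // F1 // s0.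
apply: wp_seq.
apply: wp_mono (H2 true k X W n s2 k0 Xn s20 s2N A2) => // s3 F3 s3A.
have s3N : s3 vN 0%N = n%:R by rewrite F3.
have A3 b l : (l < n + n)%N -> s3 (acc b) l = weighted_dtab k X W b l.
  by move=> ln; case: b; [exact: s3A|rewrite F3 //; exact: s2A].
apply: wp_seq; apply: wp_mono (H3 _ n s3 n0 s3N A3) => // s4 _.
case=> [[b [l [ln s4B s4L s4T]]] Hmin].
apply: wp_mono (H4 b l s4 s4B s4L) => [|s5 _ out]; first by rewrite leq_mul.
by exists b, l; split => // b' l' /(Hmin b'); rewrite s4T.
Qed.

Theorem theorem1 (R : realType) :
  exists (P : prog) (c : nat),
  forall (k : nat) (x : 'I_k -> seq rat) (w : 'I_k -> rat),
    (0 < k)%N ->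
    (forall i : 'I_k, binary_series (x i)) ->
    (forall i : 'I_k, 0 <= w i) ->
    exists (t : nat) (s : store) (z : seq rat),
      [/\ exec P (load (encode_sample x w)) t s,
          (t <= c * (k * (\max_(i < k) size (x i)) ^ 3))%N,
          holds_output s (encode_series z),
          binary_series z
        & forall z' : seq rat, binary_series z' ->
            frechet R x w z <= frechet R x w z'].
Proof.
have [K HK] := wp_binary_dtw_mean.
exists binary_dtw_mean, K => k x w k0 Hx w0.
pose X := extend _ [::] k x; pose W := extend _ 0 k w.
have Xx (i : 'I_k) : X i = x i := extendE _ _ _ _ _.
have Ww (i : 'I_k) : W i = w i := extendE _ _ _ _ _.
have x0 (i : 'I_k) : (0 < size (x i))%N.
  by have /andP[] := Hx i; rewrite -size_eq0 lt0n.
have X0 i : (i < k)%N -> (0 < size (X i))%N.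
  by move=> ik; rewrite -[i]/(val (Ordinal ik)) Xx.
have maxE : (\max_(i < k) size (X i) = \max_(i < k) size (x i))%N.
  by apply: eq_bigr => i _; rewrite Xx.
set n := (\max_(i < k) size (x i))%N in maxE *.
have load0 a i : a != 0%N -> load (encode_sample x w) a i = 0.
  by rewrite /load => /negbTE ->.
have [t [s [Hex le [b [l [out Hmin]]]]]] :=
  HK k X W _ k0 X0 (holds_input_load k x w) load0.
rewrite maxE in le Hmin.
exists t, s, (mkseq (alt b) l.+1); split => //; first exact: binary_alt.
move=> z' Hz'; rewrite !frechet_dtab ?binary_alt // ler_rat.
have n0 : (0 < n)%N.
  apply: leq_trans (x0 (Ordinal k0)) _.
  exact: (@leq_bigmax _ (fun i : 'I_k => size (x i))).
have xn (i : 'I_k) : ((size (x i)).-1 < n)%N.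
  rewrite prednK //; exact: (@leq_bigmax _ (fun i : 'I_k => size (x i))).
have -> : \sum_(i < k) w i * dtab (nth 0 (mkseq (alt b) l.+1)) (nth 0 (x i))
    (size (mkseq (alt b) l.+1)).-1 (size (x i)).-1 = weighted_dtab k X W b l.
  apply: eq_bigr => i _; rewrite Xx Ww size_mkseq; congr (_ * _).
  by apply: eq_dtab => // l' le'; rewrite nth_mkseq.
have /andP[z'0 /allP z'01] := Hz'.
have z'b i : (i <= (size z').-1)%N -> nth 0 z' i = 0 \/ nth 0 z' i = 1.
  move=> le'; have /z'01 : nth 0 z' i \in z'.
    by rewrite mem_nth // -[size z']prednK ?ltnS // lt0n size_eq0.
  by case/orP => /eqP; [left|right].
have [b' b'E] : exists b' : bool, nth 0 z' 0 = b'%:R.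
  by case: (z'b 0%N (leq0n _)) => ->; [exists false|exists true].
(* The competitor [z'] is compressed to its runs and shortened below [n + n], where the selected
   candidate is at least as good. Nonnegative weights allow the comparison sample by sample. *)
have [l' l'n Hl'] := alt_bounded b' n (changes (nth 0 z') (size z').-1) n0.
apply: le_trans (Hmin b' l' l'n) _; apply: ler_sum => i _.
rewrite Xx Ww; apply: ler_wpM2l => //.
exact: le_trans (Hl' _ _ (xn i)) (dtab_alt_le _ _ _ _ _ z'b b'E).
Qed.
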